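(* Let $d\ge2$, $\eta>0$, $T>0$, and let $G\subset\mathbb R^d$ be a domain of the form $$G=\bigcup_{j=1}^{j_0}\bigl(G_j+R_jV_{\lambda^{(j)}}\bigr),$$ where $j_0\in\mathbb N$, the $G_j\subset\mathbb R^d$ are open bounded sets, the $R_j$ are orthogonal operators on $\mathbb R^d$, and $\lambda^{(j)}=(\lambda^{(j)}_1,\dots,\lambda^{(j)}_d)$ with $\lambda^{(j)}_i\ge1$ for $1\le i\le d-1$, $\lambda^{(j)}_d=1$, and $\lambda_1^{(j)}+\dots+\lambda_d^{(j)}=\Lambda$ for all $j$, with $\Lambda$ independent of $j$. Then there are constants $\alpha_j\in(0,1]$, $1\le j\le j_0$, such that $G$ is a finite union of domains each of which either satisfies the cone condition or, for some $j\in\{1,\dots,j_0\}$, belongs to the class $\mathcal G'_{\varphi_1,\dots,\varphi_{d-1}}$ with $\varphi_i(t)=\alpha_j\,t^{\lambda_i^{(j)}}$, $i=1,\dots,d-1$.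
   Context: **The sets $V_\lambda$.** For $\lambda=(\lambda_1,\dots,\lambda_d)$ with $\lambda_i\ge 1$ for $i\le d-1$ and $\lambda_d=1$, and for $0<t\le T$, put $t^\lambda[-\eta,\eta]^d=\prod_{i=1}^d[-t^{\lambda_i}\eta,t^{\lambda_i}\eta]$. With $e_1,\dots,e_d$ the standard basis of $\mathbb R^d$, $V_\lambda=\bigcup_{0<t\le T}\bigl(-te_d+t^\lambda[-\eta,\eta]^d\bigr)$. Sums of sets are Minkowski sums. **Cone condition.** A domain $D\subset\mathbb R^d$ satisfies the cone condition if for each $x\in D$ there is a right circular cone $V_x$ with vertex at $0$, of fixed aperture angle and fixed height (independent of $x$), such that $x+V_x\subset D$. **Class $\mathcal G_{\varphi_1,\dots,\varphi_{d-1}}$.** For non-decreasing $\varphi_i:(0,1]\to(0,1]$, a domain $\Omega\subset\mathbb R^d$ belongs to $\mathcal G_{\varphi_1,\dots,\varphi_{d-1}}$ if $\Omega=\{(x',x_d):x'\in(0,1)^{d-1},\ 0<x_d<\psi(x')\}$, where $\psi:[0,1]^{d-1}\to(0,\infty)$ satisfies: for every $t\in(0,1]$, $|\psi(x')-\psi(y')|\le t$ whenever $|x_i-y_i|\le\varphi_i(t)$ for all $i=1,\dots,d-1$; and $\min_{[0,1]^{d-1}}\psi\in[1,2]$. **Class $\mathcal G'_{\varphi_1,\dots,\varphi_{d-1}}$.** A domain $\Omega$ belongs to $\mathcal G'_{\varphi_1,\dots,\varphi_{d-1}}$ if $\Omega=\bigcup_{j}T_j(D_j)$ is a finite union with $D_j\in\mathcal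 G_{\varphi_1,\dots,\varphi_{d-1}}$ and each $T_j$ a composition of a homothety, an orthogonal operator and a translation. *)

(* Defs.v *)
From HB Require Import structures.
From mathcomp Require Import all_boot all_order all_algebra.
From mathcomp Require Import all_classical all_reals all_analysis.

Set Implicit Arguments.
Unset Strict Implicit.
Unset Printing Implicit Defensive.

Import Order.TTheory GRing.Theory Num.Theory.
Import numFieldNormedType.Exports.

Local Open Scope classical_set_scope.
Local Open Scope ring_scope.

(* The ambient space R^d is ['rV[R]_n.+1] with d = n.+1: the distinguished last
   coordinate x_d is [x 0 ord_max], and x' = (x_1, ..., x_(d-1)) is
   [col' ord_max x : 'rV[R]_n], with entries [x 0 (lift ord_max i)].
   The library norm on ['rV[R]_n.+1] is the sup norm; it is only used for
   topology and boundedness, so Euclidean notions are defined separately. *)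

Section Euclidean.
Context {R : realType} {d : nat}.
Implicit Types (x y v xi : 'rV[R]_d) (Q : 'M[R]_d).

Definition dotp x y : R := \sum_(i < d) x 0 i * y 0 i.

Definition enorm x : R := Num.sqrt (dotp x x).

(* Linear operators act on row vectors by [x |-> x *m Q]. *)
Definition orthogonal_mx Q : Prop := Q *m Q^T = 1%:M.

Definition minkowski_sum (A B : set 'rV[R]_d) : set 'rV[R]_d :=
  [set x + y | x in A & y in B].

(* A homothety of arbitrary centre and ratio k <> 0, an orthogonal operator and
   a translation, composed in any order, always give a map of this form. *)
Definition similarity (f : 'rV[R]_d -> 'rV[R]_d) : Prop :=
  exists (k : R) (Q : 'M[R]_d) (b : 'rV[R]_d),
    [/\ k != 0, orthogonal_mx Q & forall x, f x = k *: (x *m Q) + b].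

(* Closed right circular cone with vertex 0, unit axis xi, height h and full
   aperture angle a: the vectors making an angle at most a / 2 with xi. *)
Definition circular_cone xi (a h : R) : set 'rV[R]_d :=
  [set v | cos (a / 2) * enorm v <= dotp v xi <= h].

End Euclidean.

Section Domains.
Context {R : realType} {n : nat}.
Implicit Types (D Omega : set 'rV[R]_n.+1) (lam : 'rV[R]_n.+1).

Definition domain D : Prop := [/\ open D, connected D & D !=set0].

Definition cone_condition D : Prop :=
  domain D /\
  exists a h : R, [/\ 0 < a < pi, 0 < h &
    forall x, D x -> exists2 xi : 'rV[R]_n.+1, enorm xi = 1 &
      [set x + v | v in circular_cone xi a h] `<=` D].

Definition aniso_box lam (eta t : R) : set 'rV[R]_n.+1 :=
  [set y | forall i, - (t `^ lam 0 i * eta) <= y 0 i <= t `^ lam 0 i * eta].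

Definition V_set (eta T : R) lam : set 'rV[R]_n.+1 :=
  \bigcup_(t in [set t : R | 0 < t <= T])
    [set - t *: delta_mx 0 ord_max + y | y in aniso_box lam eta t].

Definition closed_cube : set 'rV[R]_n := [set x | forall i, 0 <= x 0 i <= 1].

Definition open_cube : set 'rV[R]_n := [set x | forall i, 0 < x 0 i < 1].

(* f maps (0, 1] into (0, 1] and is non-decreasing there; the values of f
   outside (0, 1] are irrelevant. *)
Definition modulus (f : R -> R) : Prop :=
  (forall t, 0 < t <= 1 -> 0 < f t <= 1) /\
  (forall s t, 0 < s -> s <= t -> t <= 1 -> f s <= f t).

(* Only the restriction of psi to [closed_cube] matters. *)
Definition class_G (phi : 'I_n -> R -> R) Omega : Prop :=
  (forall i, modulus (phi i)) /\
  exists psi : 'rV[R]_n -> R,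
    [/\ forall x, closed_cube x -> 0 < psi x,
        forall t, 0 < t <= 1 -> forall x y, closed_cube x -> closed_cube y ->
          (forall i, `|x 0 i - y 0 i| <= phi i t) -> `|psi x - psi y| <= t,
        exists z, [/\ closed_cube z, forall y, closed_cube y -> psi z <= psi y
                    & 1 <= psi z <= 2]
      & Omega = [set x | open_cube (col' ord_max x) /\
                         0 < x 0 ord_max < psi (col' ord_max x)]].

Definition class_G' (phi : 'I_n -> R -> R) Omega : Prop :=
  domain Omega /\
  exists (m : nat) (D : 'I_m -> set 'rV[R]_n.+1)
         (f : 'I_m -> 'rV[R]_n.+1 -> 'rV[R]_n.+1),
    [/\ forall j, class_G phi (D j), forall j, similarity (f j)
      & Omega = \bigcup_j (f j @` D j)].

End Domains.

(* Main.v *)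
Require Import Defs.
From HB Require Import structures.
From mathcomp Require Import all_boot all_order all_algebra.
From mathcomp Require Import all_classical all_reals all_analysis.
From mathcomp Require Import ring lra.

Set Implicit Arguments.
Unset Strict Implicit.
Unset Printing Implicit Defensive.

Import Order.TTheory GRing.Theory Num.Theory.
Import numFieldNormedType.Exports.

Local Open Scope classical_set_scope.
Local Open Scope ring_scope.

(** Undo the rotation and cut each [G_j] into finitely many small open cells [A].
    The part of [A + V] coming from parameters [t >= e] is a union of boxes with
    sides bounded below that all meet a common box, so it is connected and
    satisfies the cone condition. If [eta < 1], the upper boundary of the part
    with [t <= e] over [x'] is the supremum of the heights [g_d - (1 - eta) t]
    over [g] in [A] and [t] with [|x_i - g_i| <= t^lam_i eta]. Replacing [t] by
    [t + tau] absorbs a shift of [x_i] by [tau^lam_i eta], because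
    [t^l + tau^l <= (t + tau)^l] for [l >= 1]; this is the required modulus of
    continuity. The subgraph of this function over a small cube stays in [A + V]
    and contains everything with [t <= e]. If [eta >= 1], the boxes are nested
    and the horn is a single box. *)

(** * Topology of row vectors *)

Section Connected.
Context {T : topologicalType}.
Implicit Types (A : set T) (x y : T).

(** A connected subset, rather than a path, serves as the link, so that transitivity is just a union
    of two connected sets with a common point. *)
Definition joined A x y : Prop :=
  exists C, [/\ connected C, C `<=` A, C x & C y].

Lemma joined_sym A x y : joined A x y -> joined A y x.
Proof. by move=> [C []]; exists C. Qed.

Lemma joined_trans A x y z : joined A x y -> joined A y z -> joined A x z.
Proof.
move=> [C [cC CA Cx Cy]] [C' [cC' CA' Cy' Cz]]; exists (C `|` C'); split.
- by apply: connectedU => //; exists y.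
- by rewrite subUset.
- by left.
- by right.
Qed.

Lemma joined_connected A p : (forall x, A x -> joined A p x) -> connected A.
Proof.
move=> Ap; have [[x0 Ax0]|A0] := pselect (A !=set0); last first.
  by have -> : A = set0 by [apply/seteqP; split=> x Ax //; case: A0; exists x];
     exact: connected0.
have -> : A = \bigcup_(C in [set C | [/\ connected C, C `<=` A & C p]]) C.
  apply/seteqP; split=> [x /Ap[C [cC CA Cp Cx]]|x [C [_ CA _] /CA //]].
  by exists C.
by apply: bigcup_connected => [|C []//]; exists p => C [].
Qed.

End Connected.

Section RowVectors.
Context {R : realType} {d : nat}.
Implicit Types (x y : 'rV[R]_d) (A B : set 'rV[R]_d).

Lemma ball_rVP x (e : R) y : 0 < e ->
  ball x e y <-> forall i, `|x 0 i - y 0 i| < e.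
Proof.
move=> e0; split=> [[_ xy] i|xy]; first exact: xy.
by split=> // i j; rewrite (ord1 i); exact: xy.
Qed.

Lemma open_rVP A : open A <->
  forall x, A x -> exists2 e : R, 0 < e &
    forall y, (forall i, `|x 0 i - y 0 i| < e) -> A y.
Proof.
rewrite openE; split=> [oA x /oA /nbhs_ballP[e /= e0 xeA]|oA x /oA[e e0 xeA]].
  by exists e => // y xy; apply: xeA; exact/(ball_rVP _ _ e0).
by apply/nbhs_ballP; exists e => // y /(ball_rVP _ _ e0)/xeA.
Qed.

Lemma joined_segment A x y :
  (forall t : R, 0 <= t <= 1 -> A (x + t *: (y - x))) -> joined A x y.
Proof.
move=> xyA; exists ((fun t : R => x + t *: (y - x)) @` `[0, 1]%classic); split.
- apply: connected_continuous_connected; first exact: segment_connected.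
  apply: continuous_subspaceT => t; apply: cvgD; first exact: cvg_cst.
  by apply: cvgZr_tmp; exact: cvg_id.
- by move=> z [t /=]; rewrite in_itv/= => t01 <-; exact: xyA.
- by exists 0; rewrite /= ?in_itv/= ?lexx ?ler01// scale0r addr0.
- by exists 1; rewrite /= ?in_itv/= ?lexx ?ler01// scale1r addrC subrK.
Qed.

Lemma compact_finite_cover A (e : R) : compact A -> 0 < e ->
  exists s : seq 'rV[R]_d,
    forall x, A x -> exists2 p, p \in s & forall i, `|p 0 i - x 0 i| < e.
Proof.
move=> cA e0.
move: cA; rewrite compact_cover => /(_ _ A (fun p => (ball p e)^°)) [].
- by move=> i _; exact: open_interior.
- move=> x Ax; exists x => //; exact: nbhsx_ballx.
- move=> D' _ cov; exists (finmap.enum_fset D') => x Ax.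
  have [p /= pD' /interior_subset px] := cov x Ax.
  by exists p => //; exact/(ball_rVP _ _ e0).
Qed.

(** The sum is a union of translates of [A], so [B] may be arbitrary. *)
Lemma minkowski_sum_open A B : open A -> open (minkowski_sum A B).
Proof.
move=> /open_rVP oA; apply/open_rVP => _ [x Ax [y By <-]].
have [e e0 xeA] := oA _ Ax; exists e => // z xyz.
exists (z - y); last by exists y; rewrite ?subrK.
by apply: xeA => i; have := xyz i; rewrite !mxE opprB addrA.
Qed.

End RowVectors.

(** * Orthogonal maps and similarities *)

Section Similarities.
Context {R : realType} {d : nat}.
Implicit Types (x y v xi : 'rV[R]_d) (Q : 'M[R]_d) (A : set 'rV[R]_d).

Lemma mulmxr_continuous Q : continuous (fun x => x *m Q).
Proof.
have -> : (fun x => x *m Q) = (fun x => \sum_i x 0 i *: row i Q).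
  by apply/funext => x; rewrite mulmx_sum_row.
apply: continuous_big => [|i _ x]; first exact: add_continuous.
by apply: continuousZr_tmp; exact: coord_continuous.
Qed.

Lemma orthogonal_mxV Q : orthogonal_mx Q -> Q^T *m Q = 1%:M.
Proof. exact: mulmx1C. Qed.

Lemma dotp_mulmx Q x y : orthogonal_mx Q -> dotp (x *m Q) (y *m Q) = dotp x y.
Proof.
have dE u v : dotp u v = (u *m v^T) 0 0.
  by rewrite mxE; apply: eq_bigr => i _; rewrite mxE.
by move=> oQ; rewrite !dE trmx_mul mulmxA -[x *m Q *m _]mulmxA oQ mulmx1.
Qed.

Lemma enorm_mulmx Q x : orthogonal_mx Q -> enorm (x *m Q) = enorm x.
Proof. by move=> oQ; rewrite /enorm dotp_mulmx. Qed.

Lemma similarity_mulmx Q : orthogonal_mx Q -> similarity (fun x => x *m Q).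
Proof.
by exists 1, Q, 0; split=> // x; rewrite scale1r addr0.
Qed.

End Similarities.

Section DomainImages.
Context {R : realType} {n : nat}.
Implicit Types (D : set 'rV[R]_n.+1) (f : 'rV[R]_n.+1 -> 'rV[R]_n.+1).

Lemma affine_continuous (k : R) (Q : 'M[R]_n.+1) (b : 'rV[R]_n.+1) :
  continuous (fun x : 'rV[R]_n.+1 => k *: (x *m Q) + b).
Proof.
have cZ : continuous (fun x : 'rV[R]_n.+1 => k *: (x *m Q)).
  move=> x; exact: (cvgZl_tmp (@mulmxr_continuous R _ Q x)).
move=> x; exact: (cvgD (cZ x) (cvg_cst b)).
Qed.

Lemma domain_similarity D f : domain D -> similarity f -> domain (f @` D).
Proof.
move=> [oD cD [x0 Dx0]] [k [Q [b [k0 oQ fE]]]].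
have cf : continuous f.
  by have -> : f = (fun x => k *: (x *m Q) + b) by [apply/funext];
     exact: affine_continuous.
pose g y := k^-1 *: (y *m Q^T) + - k^-1 *: (b *m Q^T).
have fK : cancel f g.
  move=> x; rewrite /g fE mulmxDl -scalemxAl -mulmxA oQ mulmx1 scalerDr scalerA.
  by rewrite mulVf// scale1r scaleNr addrK.
have gK : cancel g f.
  move=> y; rewrite fE /g mulmxDl -!scalemxAl -!mulmxA orthogonal_mxV// !mulmx1.
  by rewrite scalerDr !scalerA mulrN divff// scale1r scaleN1r subrK.
split.
- have -> : f @` D = g @^-1` D.
    apply/seteqP; split=> [_ [x Dx <-]|y Dy]; first by rewrite /= fK.
    by exists (g y).
  by apply: open_comp => // x _; exact: affine_continuous.
- by apply: connected_continuous_connected => //; exact: continuous_subspaceT.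
- by exists (f x0), x0.
Qed.

Lemma class_G'_similarity phi D f :
  domain D -> class_G phi D -> similarity f -> class_G' phi (f @` D).
Proof.
move=> dD GD sf; split; first exact: domain_similarity.
exists 1%N, (fun=> D), (fun=> f); split=> //.
apply/seteqP; split=> [x fDx|x [_ _ //]].
by exists ord0.
Qed.

Lemma cone_condition_mulmx D (Q : 'M[R]_n.+1) : orthogonal_mx Q ->
  cone_condition D -> cone_condition ((fun x => x *m Q) @` D).
Proof.
move=> oQ [dD [a [h [a0 h0 cDa]]]]; split.
  by apply: domain_similarity => //; exact: similarity_mulmx.
exists a, h; split=> // _ [x Dx <-].
have [xi xi1 xiD] := cDa x Dx; exists (xi *m Q); first by rewrite enorm_mulmx.
move=> _ [v Cv <-]; exists (x + v *m Q^T); last first.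
  by rewrite mulmxDl -mulmxA orthogonal_mxV// mulmx1.
apply: xiD; exists (v *m Q^T) => //; move: Cv; rewrite /circular_cone /=.
rewrite -(dotp_mulmx (v *m _) xi oQ) -(enorm_mulmx (v *m _) oQ).
by rewrite -mulmxA orthogonal_mxV// mulmx1.
Qed.

End DomainImages.

(** * Graph domains and unions of boxes *)

(** The reciprocal of one plus the sum of the reciprocals replaces a minimum and stays meaningful
    when [I] is empty. *)
Lemma positive_lower_bound (R : realFieldType) (I : finType) (f : I -> R) :
  (forall i, 0 < f i) -> exists2 e, 0 < e & forall i, e <= f i.
Proof.
move=> f0; have S0 i : (f i)^-1 <= 1 + \sum_j (f j)^-1.
  rewrite (bigD1 i)//= addrCA lerDl addr_ge0// sumr_ge0// => j _.
  by rewrite invr_ge0 ltW.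
have S1 : 0 < 1 + \sum_j (f j)^-1.
  by rewrite ltr_wpDr// sumr_ge0// => j _; rewrite invr_ge0 ltW.
exists (1 + \sum_j (f j)^-1)^-1 => [|i]; first by rewrite invr_gt0.
by rewrite -[leRHS]invrK lef_pV2 ?posrE ?invr_gt0.
Qed.

Lemma convex_comb_between (R : realDomainType) (x y t : R) : 0 <= t <= 1 ->
  x <= x + t * (y - x) <= y \/ y <= x + t * (y - x) <= x.
Proof.
move=> /andP[t0 t1]; have [xy|/ltW yx] := leP x y; [left|right].
  by rewrite lerDl mulr_ge0 ?subr_ge0//= -lerBrDl ler_piMl ?subr_ge0.
by rewrite gerDl mulr_ge0_le0 ?subr_le0// andbT -lerBlDl ler_niMl ?subr_le0.
Qed.

Section AppendLast.
Context {R : realType} {n : nat}.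

Lemma ord_max_ind (P : 'I_n.+1 -> Prop) :
  P ord_max -> (forall i, P (lift ord_max i)) -> forall i, P i.
Proof. by move=> Pm Pl i; have [j ->|->] := unliftP ord_max i. Qed.

Definition append_last (x : 'rV[R]_n) (a : R) : 'rV[R]_n.+1 :=
  \row_j oapp (x 0) a (unlift ord_max j).

Lemma append_last_lift x a i : append_last x a 0 (lift ord_max i) = x 0 i.
Proof. by rewrite mxE liftK. Qed.

Lemma append_last_max x a : append_last x a 0 ord_max = a.
Proof. by rewrite mxE unlift_none. Qed.

Lemma col'_append_last x a : col' ord_max (append_last x a) = x.
Proof. by apply/rowP => i; rewrite mxE append_last_lift. Qed.

End AppendLast.

Section ClassGDomain.
Context {R : realType} {n : nat}.

(** The modulus condition makes [psi] continuous, whence openness. Since [psi >= 1] on the cube,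
    every point can be moved vertically to height 1/2 and then horizontally to the point over the
    centre of the cube, whence connectedness. *)
Lemma class_G_domain (phi : 'I_n -> R -> R) D : class_G phi D -> domain D.
Proof.
move=> [phim [psi [_ psi_phi [z [_ psi_min /andP[psi1 _]]] ->]]].
have psi_ge1 y : open_cube y -> 1 <= psi y.
  move=> oy; apply: le_trans psi1 (psi_min _ _) => i.
  by have /andP[/ltW-> /ltW->] := oy i.
have cube_seg (x y : 'rV[R]_n) (t : R) : 0 <= t <= 1 ->
    open_cube x -> open_cube y -> open_cube (x + t *: (y - x)).
  move=> t01 ox oy i; rewrite !mxE; have := ox i; have := oy i.
  by have [] := convex_comb_between (x 0 i) (y 0 i) t01; lra.
pose half : 'rV[R]_n := const_mx 2^-1.
have ohalf : open_cube half by move=> i; rewrite mxE; lra.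
split.
- apply/open_rVP => x [ox xpsi].
  (* Half of the gap below the graph: the last coordinate may rise by less than [r] while [psi]
     drops by at most [r]. The cap 1 keeps [r] in the range of the modulus condition. *)
  pose r := Num.min 1 ((psi (col' ord_max x) - x 0 ord_max) / 2).
  have r0 : 0 < r by rewrite lt_min; lra.
  have r1 : r <= 1 by rewrite ge_min lexx.
  have r2 : r <= (psi (col' ord_max x) - x 0 ord_max) / 2.
    by rewrite ge_min lexx orbT.
  have [e e0 ef] : exists2 e : R, 0 < e & forall i : 'I_n, e <= Num.min (phi i r)
      (Num.min (x 0 (lift ord_max i)) (1 - x 0 (lift ord_max i))).
    apply: positive_lower_bound => i; have := ox i; rewrite mxE !lt_min.
    have [phi01 _] := phim i; have := phi01 r; rewrite r0 r1 => /(_ isT); lra.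
  exists (Num.min e (Num.min r (x 0 ord_max))) => [|y xy].
    by rewrite lt_min e0 lt_min r0; have /andP[] := xpsi.
  have xyi i : `|x 0 (lift ord_max i) - y 0 (lift ord_max i)| < e.
    by have := xy (lift ord_max i); rewrite lt_min => /andP[].
  have oy : open_cube (col' ord_max y).
    move=> i; rewrite mxE; have := xyi i; have := ef i.
    by rewrite !le_min ltr_norml => /and3P[_ ? ?] /andP[? ?]; lra.
  split=> //; have := xy ord_max; rewrite !lt_min !ltr_norml.
  move=> /and3P[_ /andP[? ?] /andP[? ?]].
  suff : `|psi (col' ord_max x) - psi (col' ord_max y)| <= r.
    by rewrite ler_norml => /andP[? ?]; have /andP[? ?] := xpsi; lra.
  apply: (psi_phi r); rewrite ?r0 ?r1//.
  + by move=> i; have /andP[/ltW-> /ltW->] := ox i.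
  + by move=> i; have /andP[/ltW-> /ltW->] := oy i.
  + move=> i; rewrite !mxE; apply: le_trans (ltW (xyi i)) _.
    by have := ef i; rewrite le_min => /andP[].
- apply: (@joined_connected _ _ (append_last half 2^-1)) => x [ox xpsi].
  apply: (@joined_trans _ _ _ (append_last (col' ord_max x) 2^-1)).
    apply: joined_segment => t t01 /=.
    have -> : col' ord_max (append_last half 2^-1 + t *:
        (append_last (col' ord_max x) 2^-1 - append_last half 2^-1)) =
        half + t *: (col' ord_max x - half).
      by apply/rowP => i; rewrite !mxE !liftK /= !mxE.
    have oz := cube_seg _ _ _ t01 ohalf ox; split => //.
    rewrite !mxE unlift_none /= subrr mulr0 addr0.
    by have := psi_ge1 _ oz; lra.
  apply: joined_segment => t t01 /=.
  have -> : col' ord_max (append_last (col' ord_max x) 2^-1 + t *: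
      (x - append_last (col' ord_max x) 2^-1)) = col' ord_max x.
    by apply/rowP => i; rewrite !mxE liftK /= !mxE subrr mulr0 addr0.
  split=> //; rewrite !mxE unlift_none /=; have := psi_ge1 _ ox.
  by have [] := convex_comb_between 2^-1 (x 0 ord_max) t01; lra.
- exists (append_last half 2^-1); rewrite /= col'_append_last append_last_max.
  by split=> //; have := psi_ge1 _ ohalf; lra.
Qed.

End ClassGDomain.

(** * Cones inside boxes *)

Section ConesInBoxes.
Context {R : realType}.

Lemma enorm_ge0 d (v : 'rV[R]_d) : 0 <= enorm v.
Proof. exact: sqrtr_ge0. Qed.

Lemma dotp_ge0 d (v : 'rV[R]_d) : 0 <= dotp v v.
Proof. by apply: sumr_ge0 => i _; rewrite -expr2 sqr_ge0. Qed.

Lemma cos_half_preimage (k : R) : 0 < k < 1 ->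
  exists2 a : R, 0 < a < pi & cos (a / 2) = k.
Proof.
move=> k01; have k11 : -1 <= k < 1 by lra.
have k11' : -1 <= k <= 1 by lra.
have kK : cos (acos k) = k by rewrite acosK// in_itv.
exists (2 * acos k); last by rewrite mulrAC divff ?mul1r// pnatr_eq0.
have := acos_gt0 k11 => a0; apply/andP; split; first lra.
rewrite -ltr_pdivlMl// mulrC -ltr_cos ?in_itv/= ?acos_ge0 ?acos_lepi//.
  by rewrite cos_pihalf kK; case/andP: k01.
by have := pi_gt0 R => ?; apply/andP; split; lra.
Qed.

Lemma sign_row_unit d (s : 'I_d.+1 -> bool) :
  enorm (\row_i ((-1) ^+ s i / Num.sqrt d.+1%:R) : 'rV[R]_d.+1) = 1.
Proof.
rewrite /enorm /dotp (eq_bigr (fun=> (d.+1%:R : R)^-1)) => [|i _].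
  by rewrite sumr_const card_ord -[_^-1 *+ _]mulr_natr mulVf ?sqrtr1.
by rewrite mxE -expr2 expr_div_n sqr_sqrtr// sqrr_sign mul1r.
Qed.

(* The aperture is chosen so that subtracting from [v] its component [q xi] along
   the axis leaves a vector of square norm at most [q ^+ 2 / d.+1], which is
   [(q xi_i) ^+ 2] for every [i]; hence [v_i] has the sign of [xi_i]. *)
Lemma circular_cone_orthant d : exists2 a : R, 0 < a < pi &
  forall (s : 'I_d.+1 -> bool) (h : R) v,
    circular_cone (\row_i ((-1) ^+ s i / Num.sqrt d.+1%:R)) a h v ->
    forall i, 0 <= (-1) ^+ s i * v 0 i <= 2 * h.
Proof.
pose N : R := d.+1%:R; pose sN := Num.sqrt N.
have N1 : 1 <= N by rewrite ler1n.
have sN2 : sN ^+ 2 = N by rewrite sqr_sqrtr//; lra.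
have sN1 : 1 <= sN by rewrite -sqrtr1 ler_sqrt//; lra.
pose k := Num.sqrt (N / (N + 1)).
have k2 : k ^+ 2 = N / (N + 1) by rewrite sqr_sqrtr// divr_ge0//; lra.
have k2E : k ^+ 2 * (N + 1) = N by rewrite k2 divfK//; lra.
have k0 : 0 < k by rewrite sqrtr_gt0 divr_gt0//; lra.
have k1 : k < 1 by rewrite -sqrtr1 ltr_sqrt// ltr_pdivrMr; lra.
have [|a a0 aE] := @cos_half_preimage k; first by rewrite k0.
exists a => // s h v; set xi := \row_i _; rewrite /circular_cone /= aE.
have xi1 : dotp xi xi = 1.
  by rewrite -[LHS]sqr_sqrtr ?dotp_ge0// -/(enorm xi) sign_row_unit expr1n.
have [q qE] : exists q, dotp v xi = q by exists (dotp v xi).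
rewrite qE => /andP[kq qh] i.
have q0 : 0 <= q by apply: le_trans kq; rewrite mulr_ge0 ?enorm_ge0//; lra.
have vq : k ^+ 2 * dotp v v <= q ^+ 2.
  rewrite -[dotp v v]sqr_sqrtr ?dotp_ge0// -/(enorm v) -exprMn.
  by rewrite ler_sqr ?nnegrE// mulr_ge0 ?enorm_ge0//; lra.
(* Pythagoras: one squared coordinate of the component of [v] orthogonal to [xi] is at most the
   squared norm of that component. *)
have res : (v 0 i - q * xi 0 i) ^+ 2 <= dotp v v - q ^+ 2.
  have -> : dotp v v - q ^+ 2 = \sum_j (v 0 j - q * xi 0 j) ^+ 2.
    transitivity (dotp v v - 2 * q * dotp v xi + q ^+ 2 * dotp xi xi).
      by rewrite xi1 qE; ring.
    rewrite /dotp !mulr_sumr -sumrB -big_split /=.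
    by apply: eq_bigr => j _; ring.
  by rewrite (bigD1 i)//= lerDl sumr_ge0// => j _; exact: sqr_ge0.
set u := (-1) ^+ s i * v 0 i; set p := q / sN.
have p0 : 0 <= p by rewrite divr_ge0//; lra.
have uE : (v 0 i - q * xi 0 i) ^+ 2 = (u - p) ^+ 2.
  have -> : u - p = (-1) ^+ s i * (v 0 i - q * xi 0 i).
    have -> : q * xi 0 i = (-1) ^+ s i * p by rewrite mxE mulrCA.
    by rewrite mulrBr [_ * (_ * p)]mulrA -expr2 sqrr_sign mul1r.
  by rewrite exprMn sqrr_sign mul1r.
have pE : p ^+ 2 * N = q ^+ 2.
  by rewrite -sN2 -exprMn divfK//; lra.
(* Hence [u] lies between 0 and [2 * p], and [p <= q <= h]. *)
have up : (u - p) ^+ 2 <= p ^+ 2.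
  rewrite -uE; apply: le_trans res _; have := dotp_ge0 v; nra.
have pq : p <= q by rewrite ler_pdivrMr; nra.
by apply/andP; split; nra.
Qed.

(** From [x] the cone points diagonally into the orthant directed towards the centre of the box.
    With height [r / 2] each coordinate moves towards the centre by at most [r <= w i], so it cannot
    overshoot the opposite face. *)
Lemma cone_condition_boxes n (D : set 'rV[R]_n.+1) (r : R) :
  domain D -> 0 < r ->
  (forall x, D x -> exists (c : 'rV[R]_n.+1) (w : 'I_n.+1 -> R),
    [/\ forall i, r <= w i, forall i, `|x 0 i - c 0 i| <= w i &
        forall y : 'rV[R]_n.+1, (forall i, `|y 0 i - c 0 i| <= w i) -> D y]) ->
  cone_condition D.
Proof.
move=> dD r0 boxD; split=> //; have [a a0 aP] := circular_cone_orthant n.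
exists a, (r / 2); split=> //; first by rewrite divr_gt0.
move=> x /boxD[c [w [rw xw wD]]].
exists (\row_i ((-1) ^+ (c 0 i <= x 0 i)%R / Num.sqrt n.+1%:R)).
  exact: (@sign_row_unit _ (fun i => c 0 i <= x 0 i)).
move=> _ [v /aP vP <-]; apply: wD => i; have := vP i; have := rw i; have := xw i.
rewrite mxE !ler_norml; case: (leP (c 0 i) (x 0 i)) => cx /=;
  rewrite ?expr1 ?expr0 => /andP[? ?] ? /andP[? ?]; apply/andP; split; lra.
Qed.

End ConesInBoxes.

(** * Anisotropic horns *)

Section PowerEstimates.
Context {R : realType}.
Implicit Types s t l : R.

Lemma powR_le_id t l : 0 < t -> t <= 1 -> 1 <= l -> t `^ l <= t.
Proof.
by move=> t0 t1 l1; rewrite -[leRHS](powRr1 (ltW t0)) ger_powR ?t0.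
Qed.

Lemma powR_ge_id t l : 1 <= t -> 1 <= l -> t <= t `^ l.
Proof.
by move=> t1 l1; rewrite -[leLHS](powRr1 (le_trans ler01 t1)); exact: ler_powR.
Qed.

Lemma le_powR_le s t l : 0 < s -> s <= t -> 0 <= l -> s `^ l <= t `^ l.
Proof.
move=> s0 st l0; rewrite ge0_ler_powR ?nnegrE ?(ltW s0)//.
exact: le_trans (ltW s0) st.
Qed.

(** Write $x^l = x\,x^{l-1}$ and bound both $s^{l-1}$ and $t^{l-1}$ by $(s+t)^{l-1}$. *)
Lemma powR_superadditive s t l : 0 < s -> 0 < t -> 1 <= l ->
  s `^ l + t `^ l <= (s + t) `^ l.
Proof.
move=> s0 t0 l1; have l0 : l != 0 by rewrite gt_eqF// (lt_le_trans ltr01).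
have st0 : 0 < s + t by exact: addr_gt0.
have powE x : 0 < x -> x `^ l = x * x `^ (l - 1).
  by move=> x0; rewrite mulr_powRB1 ?ltW// (lt_le_trans ltr01).
rewrite (powE s)// (powE t)// (powE (s + t))// mulrDl.
by apply: lerD; (apply: ler_wpM2l; first exact: ltW);
  apply: le_powR_le; rewrite ?subr_ge0// ?lerDl ?lerDr ltW.
Qed.

End PowerEstimates.

Section Horns.
Context {R : realType} {n : nat}.
Implicit Types (A : set 'rV[R]_n.+1) (P : set R) (lam : 'rV[R]_n.+1).

(** [V_set eta T lam] is the case $P = (0, T]$. Leaving [P] free allows the horn to be cut into its
    tip and a truncated part. *)
Definition horn eta P lam : set 'rV[R]_n.+1 :=
  \bigcup_(t in P)
    [set - t *: delta_mx 0 ord_max + y | y in aniso_box lam eta t].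

Lemma sum_hornP eta P lam A x : minkowski_sum A (horn eta P lam) x <->
  exists g t, [/\ A g, P t & forall i,
    `|x 0 i - (g - t *: delta_mx 0 ord_max) 0 i| <= t `^ lam 0 i * eta].
Proof.
split=> [[g Ag [_ [t Pt [y ty <-]] <-]]|[g [t [Ag Pt xgt]]]].
  exists g, t; split=> // i.
  have -> : (g + (- t *: delta_mx 0 ord_max + y)) 0 i -
            (g - t *: delta_mx 0 ord_max) 0 i = y 0 i by rewrite !mxE; ring.
  by rewrite ler_norml; exact: ty.
exists g => //; exists (x - g).
  exists t => //; exists (x - (g - t *: delta_mx 0 ord_max)) => [i|].
    by have := xgt i; rewrite ler_norml !mxE.
  by rewrite scaleNr opprB addrCA addKr.
by rewrite addrC subrK.
Qed.

Lemma sub_delta_lift (g : 'rV[R]_n.+1) t i :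
  (g - t *: delta_mx 0 ord_max) 0 (lift ord_max i) = g 0 (lift ord_max i).
Proof.
by rewrite !mxE eq_sym (negbTE (neq_lift _ _)) andbF mulr0 subr0.
Qed.

Lemma sub_delta_max (g : 'rV[R]_n.+1) t :
  (g - t *: delta_mx 0 ord_max) 0 ord_max = g 0 ord_max - t.
Proof. by rewrite !mxE !eqxx mulr1. Qed.

Lemma joined_box (D : set 'rV[R]_n.+1) (c x : 'rV[R]_n.+1) (w : 'I_n.+1 -> R) :
  (forall y : 'rV[R]_n.+1, (forall i, `|y 0 i - c 0 i| <= w i) -> D y) ->
  (forall i, `|x 0 i - c 0 i| <= w i) -> joined D x c.
Proof.
move=> wD xw; apply: joined_segment => t /andP[t0 t1]; apply: wD => i.
have -> : (x + t *: (c - x)) 0 i - c 0 i = (1 - t) * (x 0 i - c 0 i).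
  by rewrite !mxE; ring.
apply: le_trans (xw i); rewrite normrM ler_piMl//.
by rewrite ger0_norm ?subr_ge0// gerBl.
Qed.

Lemma truncated_horn_cone_condition eta T e lam A : 0 < eta -> 0 < e -> e <= T ->
  open A -> A !=set0 ->
  (forall g h, A g -> A h -> forall i, `|g 0 i - h 0 i| <= T `^ lam 0 i * eta) ->
  (forall i, 0 <= lam 0 i) ->
  cone_condition (minkowski_sum A (horn eta [set t | e <= t <= T] lam)).
Proof.
move=> eta0 e0 eT oA [g0 Ag0] diamA lam0; set D := minkowski_sum _ _.
pose ctr (g : 'rV[R]_n.+1) t := g - t *: delta_mx 0 ord_max.
have boxD g t : A g -> e <= t <= T -> forall y : 'rV[R]_n.+1,
    (forall i, `|y 0 i - ctr g t 0 i| <= t `^ lam 0 i * eta) -> D y.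
  by move=> Ag et y yt; apply/sum_hornP; exists g, t.
have w0 t i : 0 < t -> 0 < t `^ lam 0 i * eta.
  by move=> t0; rewrite mulr_gt0// powR_gt0.
have Dctr g t : A g -> e <= t <= T -> D (ctr g t).
  move=> Ag et; apply: (boxD g t) => // i; rewrite subrr normr0 ltW// w0//.
  by case/andP: et => + _; exact: lt_le_trans.
have eTT : e <= T <= T by rewrite eT lexx.
have dD : domain D.
  split; first exact: minkowski_sum_open.
  (* From [x] go to the centre of its box, slide the centre down to parameter [T], and finish inside
     the box of [g0] at [T], which contains [ctr g T] by [diamA]. *)
  - apply: (@joined_connected _ _ (ctr g0 T)) => x /sum_hornP[g [t [Ag Pt xgt]]].
    apply: joined_sym; apply: joined_trans (joined_box (boxD g t Ag Pt) xgt) _.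
    apply: (@joined_trans _ _ _ (ctr g T)).
      apply: joined_segment => s s01.
      have -> : ctr g t + s *: (ctr g T - ctr g t) = ctr g (t + s * (T - t)).
        by apply/rowP => i; rewrite !mxE; ring.
      apply: Dctr => //; case/andP: (Pt) => et tT.
      by have [] := convex_comb_between t T s01; lra.
    apply: joined_box (boxD g0 T Ag0 eTT) _ => i.
    by have := diamA g g0 Ag Ag0 i; rewrite /ctr !mxE opprB addrA subrK.
  - by exists (ctr g0 T); exact: Dctr.
(* As [t >= e], the half-sides at parameter [e] bound those of all the boxes from below. *)
have [r r0 rP] : exists2 r : R, 0 < r & forall i, r <= e `^ lam 0 i * eta.
  by apply: positive_lower_bound => i; exact: w0.
apply: (@cone_condition_boxes _ _ _ r) => // x /sum_hornP[g [t [Ag Pt xgt]]].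
exists (ctr g t), (fun i => t `^ lam 0 i * eta); split=> //; last exact: boxD.
move=> i; apply: le_trans (rP i) _; rewrite ler_pM2r//.
by apply: le_powR_le => //; case/andP: Pt.
Qed.

End Horns.

(** * The upper envelope of the horns *)

Section HornProfile.
Context {R : realType} {n : nat}.
Variables (eta c : R) (lam : 'rV[R]_n.+1) (A : set 'rV[R]_n.+1) (M : R).
Hypotheses (eta0 : 0 < eta) (c0 : 0 < c)
  (lam1 : forall i : 'I_n, 1 <= lam 0 (lift ord_max i))
  (A0 : A !=set0) (AM : forall g, A g -> g 0 ord_max <= M).
Implicit Types x y : 'rV[R]_n.

(* For [c = 1 - eta], the value at [x] is the supremum of the heights at which
   the vertical line over [x] meets the horns with vertex in [A]. *)
Definition horn_heights x : set R :=
  [set u | exists g t, [/\ A g, 0 < t,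
    forall i, `|x 0 i - g 0 (lift ord_max i)| <= t `^ lam 0 (lift ord_max i) * eta
    & u = g 0 ord_max - c * t]].

Definition horn_profile x : R := sup (horn_heights x).

(** The parameter in [horn_heights] has no upper bound, so a horn that is long enough reaches any
    [x] and the supremum is a genuine one everywhere. *)
Lemma horn_heights_nonempty x : horn_heights x !=set0.
Proof.
have [g Ag] := A0.
pose S := \sum_i `|x 0 i - g 0 (lift ord_max i)|.
have S0 : 0 <= S by exact: sumr_ge0.
(* [t * eta] exceeds every horizontal distance, and [t >= 1] gives $t \le t^{\lambda_i}$. *)
pose t := 1 + S / eta; have t1 : 1 <= t by rewrite lerDl divr_ge0// ltW.
exists (g 0 ord_max - c * t), g, t; split=> // [|i]; first lra.
apply: (@le_trans _ _ (t * eta)).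
  apply: (@le_trans _ _ S).
    by rewrite /S (bigD1 i)//= lerDl sumr_ge0.
  by rewrite mulrDl mul1r divfK ?gt_eqF// lerDr ltW.
by rewrite ler_pM2r//; exact: powR_ge_id.
Qed.

Lemma horn_heights_ub x : ubound (horn_heights x) M.
Proof.
move=> _ [g [t [Ag t0 _ ->]]]; apply: le_trans (AM Ag).
by rewrite gerBl mulr_ge0// ltW.
Qed.

Lemma horn_profile_le x : horn_profile x <= M.
Proof. exact: ge_sup (horn_heights_nonempty x) (@horn_heights_ub x). Qed.

Lemma horn_profile_ge x u : horn_heights x u -> u <= horn_profile x.
Proof. by apply: ub_le_sup; exists M; exact: horn_heights_ub. Qed.

(** A competitor [(g, s)] over [x] becomes the competitor [(g, t + s)] over [y], at the cost [c * t]
    in height. *)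
Lemma horn_profile_shift x y t : 0 < t ->
  (forall i, `|x 0 i - y 0 i| <= t `^ lam 0 (lift ord_max i) * eta) ->
  horn_profile x - c * t <= horn_profile y.
Proof.
move=> t0 xyt; rewrite lerBlDr; apply: ge_sup; first exact: horn_heights_nonempty.
move=> _ [g [s [Ag s0 xgs ->]]]; rewrite -lerBlDr; apply: horn_profile_ge.
exists g, (t + s); split=> // [|i|]; [exact: addr_gt0| |by ring].
apply: le_trans (ler_distD (x 0 i) _ _) _.
apply: (@le_trans _ _
  ((t `^ lam 0 (lift ord_max i) + s `^ lam 0 (lift ord_max i)) * eta)).
  by rewrite mulrDl lerD// distrC.
by rewrite ler_pM2r// powR_superadditive.
Qed.

Lemma horn_profile_dist x y t : 0 < t ->
  (forall i, `|x 0 i - y 0 i| <= t `^ lam 0 (lift ord_max i) * eta) ->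
  `|horn_profile x - horn_profile y| <= c * t.
Proof.
move=> t0 xyt; have := horn_profile_shift t0 xyt.
have : horn_profile y - c * t <= horn_profile x.
  by apply: horn_profile_shift => // i; rewrite distrC.
rewrite ler_distl; lra.
Qed.

(** Continuity is what makes the profile attain its minimum on a closed cube. *)
Lemma horn_profile_continuous : continuous horn_profile.
Proof.
move=> x; apply/(@cvgrPdist_le _ _ _ _ (nbhs_filter x)) => /= e e0.
have t0 : 0 < e / c by rewrite divr_gt0.
have [r r0 rP] : exists2 r : R, 0 < r & forall i : 'I_n,
    r <= (e / c) `^ lam 0 (lift ord_max i) * eta.
  by apply: positive_lower_bound => i; rewrite mulr_gt0// powR_gt0.
apply/nbhs_ballP; exists r => //= y /(ball_rVP _ _ r0) xy.
have -> : e = c * (e / c) by rewrite mulrC divfK// gt_eqF.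
apply: horn_profile_dist => // i.
by apply: le_trans (rP i); exact: ltW.
Qed.

End HornProfile.

(** * The graph domain over one small cell *)

Section GraphPiece.
Context {R : realType} {n : nat}.

(* The similar copy of [Omega] has as base the cube of side [s] centred at [p],
   and its bottom lies [s] below the minimum of the horn profile on that cube,
   so that the rescaled profile has minimum 1. *)
Lemma horn_graph_piece (eta T t0 s alpha : R) (lam p : 'rV[R]_n.+1)
    (A : set 'rV[R]_n.+1) :
  0 < eta < 1 -> (forall i : 'I_n, 1 <= lam 0 (lift ord_max i)) ->
  lam 0 ord_max = 1 ->
  0 < t0 -> 2 * t0 <= T -> 0 < s -> s <= 1 -> s <= (1 - eta) * t0 ->
  (forall i : 'I_n, s <= t0 `^ lam 0 (lift ord_max i) * eta) ->
  0 < alpha <= 1 ->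
  (forall i : 'I_n, alpha <= s `^ lam 0 (lift ord_max i) * eta) ->
  open A -> A !=set0 -> (forall g, A g -> forall i, `|p 0 i - g 0 i| < s / 8) ->
  exists (Omega : set 'rV[R]_n.+1) (b : 'rV[R]_n.+1),
    [/\ class_G (fun (i : 'I_n) t => alpha * t `^ lam 0 (lift ord_max i)) Omega,
        (fun x => s *: x + b) @` Omega `<=`
          minkowski_sum A (horn eta [set t | 0 < t <= T] lam) &
        minkowski_sum A (horn eta [set t | 0 < t <= s / 8] lam) `<=`
          (fun x => s *: x + b) @` Omega].
Proof.
move=> /andP[eta0 eta1] lam1 lamd t00 t0T s0 s1 st0 sP /andP[alpha0 alpha1] alphaP
  oA A0 Ap.
(* The top face of the box of [g] at parameter [t] has height $g_d - t + t\eta = g_d - ct$. *)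
set c := 1 - eta in st0; have c0 : 0 < c by rewrite /c; lra.
have c1 : c <= 1 by rewrite /c; lra.
pose M := p 0 ord_max + s / 8.
have AM g : A g -> g 0 ord_max <= M.
  by move=> /Ap/(_ ord_max); rewrite ltr_distlC /M; lra.
pose prof := horn_profile eta c lam A.
pose b' : 'rV[R]_n := col' ord_max p - const_mx (s / 2).
have cprof : continuous (fun x : 'rV[R]_n => prof (s *: x + b')).
  have caff : continuous (fun x : 'rV[R]_n => s *: x + b').
    by move=> x; exact: (cvgD (@scaler_continuous _ _ s x) (cvg_cst b')).
  move=> x; apply: (continuous_comp (caff x)).
  exact: (horn_profile_continuous eta0 c0 lam1 A0 AM).
have cube0 : (@closed_cube R n) !=set0 by exists 0 => i; rewrite mxE lexx ler01.
have ccube : compact (@closed_cube R n).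
  have -> : @closed_cube R n =
      [set v : 'rV[R]_n | forall i, (`[0, 1]%classic : set R) (v ord0 i)].
    by apply/seteqP; split=> v vP i; have := vP i; rewrite /= in_itv.
  by apply: (@rV_compact R n (fun=> `[0, 1]%classic)) => _; exact: segment_compact.
have [z zc zmin] := EVT_min_rV cube0 ccube (continuous_subspaceT cprof).
pose m := prof (s *: z + b').
have {zmin} mP x : closed_cube x -> m <= prof (s *: x + b').
  by move=> xc; exact: (zmin x (mem_set xc)).
move: zc => /set_mem zc.
have mM : m <= M by apply: horn_profile_le.
(* Points of the base cube are horizontally within [s / 2 + s / 8 <= s] of [g], so the parameter
   [t0] competes at the minimum point. *)
have m_ge g : A g -> g 0 ord_max - c * t0 <= m.
  move=> Ag; apply: (horn_profile_ge c0 AM); exists g, t0; split=> // i.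
  apply: le_trans (sP i); have := Ap g Ag (lift ord_max i); have := zc i.
  rewrite !mxE ltr_distlC ler_norml => /andP[? ?] /andP[? ?].
  by apply/andP; split; nra.
pose psi (x : 'rV[R]_n) := (prof (s *: x + b') - m) / s + 1.
have psi1 x : closed_cube x -> 1 <= psi x.
  by move=> /mP mx; rewrite lerDr divr_ge0 ?subr_ge0// ltW.
pose b := append_last b' (m - s).
pose Omega := [set x : 'rV[R]_n.+1 | open_cube (col' ord_max x) /\
  0 < x 0 ord_max < psi (col' ord_max x)].
have fE (x : 'rV[R]_n.+1) : s *: x + b =
    append_last (s *: col' ord_max x + b') (s * x 0 ord_max + (m - s)).
  apply/rowP => i; move: i; apply: ord_max_ind => [|i].
    by rewrite append_last_max mxE append_last_max mxE.
  by rewrite append_last_lift mxE append_last_lift !mxE.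
exists Omega, b; split.
- split.
    move=> i; split=> [t /andP[tt0 tt1]|t u tt0 tu u1].
      rewrite mulr_gt0 ?powR_gt0//= mulr_ile1 ?powR_ge0 ?(ltW alpha0)//.
      exact: le_trans (powR_le_id tt0 tt1 (lam1 i)) tt1.
    by rewrite ler_pM2l// le_powR_le// (le_trans ler01).
  exists psi; split=> // [x /psi1|t /andP[tt0 tt1] x y _ _ xyt|].
  + exact: lt_le_trans.
  + have st : 0 < s * t by exact: mulr_gt0.
    have -> : psi x - psi y = (prof (s *: x + b') - prof (s *: y + b')) / s.
      by rewrite /psi; ring.
    rewrite normrM normfV (gtr0_norm s0) ler_pdivrMr// [t * s]mulrC.
    (* The profile is compared at parameter [s * t]: the shift is at most $\alpha t^{\lambda_i} \le
       (st)^{\lambda_i}\eta$ because [s <= 1] and by the choice of [alpha], and dividing by [s]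
       leaves at most [t]. *)
    apply: (@le_trans _ _ (c * (s * t))); last by rewrite ler_piMl// ltW.
    apply: (horn_profile_dist eta0 c0 lam1 A0 AM) => // i.
    have -> : (s *: x + b') 0 i - (s *: y + b') 0 i = s * (x 0 i - y 0 i).
      by rewrite !mxE; ring.
    rewrite powRM ?(ltW s0) ?(ltW tt0)// normrM (gtr0_norm s0).
    apply: (@le_trans _ _ `|x 0 i - y 0 i|); first by rewrite ler_piMl.
    apply: le_trans (xyt i) _.
    rewrite [leRHS]mulrAC ler_wpM2r ?powR_ge0//.
  + exists z; split=> // [y yc|]; last by rewrite /psi subrr mul0r add0r lexx ler1n.
    by rewrite lerD2r ler_pM2r ?invr_gt0// lerD2r; exact: mP.
- move=> _ [X [Xo /andP[Xd0 Xd]] <-]; rewrite fE.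
  set x' := s *: _ + b'; set xd := s * _ + _.
  have xd_m : m - s < xd by rewrite /xd ltrDr mulr_gt0.
  have : xd < prof x'.
    by move: Xd; rewrite /psi -ltrBlDr ltr_pdivlMr// /xd -/x'; lra.
  move=> /sup_gt[|u [g [t [Ag tt0 x'g ->]]] xdu].
    exact: horn_heights_nonempty.
  (* The parameter [t] is enlarged to [h / c], where the top face of the box of [g] is exactly at
     height [xd] and the wider base still contains [x']. Since [h < c * t0 + s <= 2 * c * t0], this
     parameter is at most [T]. *)
  have gm := m_ge g Ag; set h := g 0 ord_max - xd.
  have htau : t < h / c by rewrite ltr_pdivlMr// /h; lra.
  have hT : h / c <= T by rewrite ler_pdivrMr// /h; nra.
  apply/sum_hornP; exists g, (h / c); split=> //.
    by rewrite /= hT andbT; lra.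
  apply: ord_max_ind => [|i].
    rewrite append_last_max sub_delta_max lamd powRr1; last lra.
    have -> : xd - (g 0 ord_max - h / c) = h / c * eta.
      have : h / c * (1 - eta) = g 0 ord_max - xd by rewrite divfK// gt_eqF.
      by move: (h / c) => w; lra.
    by rewrite ger0_norm// mulr_ge0//; lra.
  rewrite append_last_lift sub_delta_lift.
  apply: le_trans (x'g i) _; rewrite ler_pM2r//.
  by apply: le_powR_le => //; [exact: ltW|exact: le_trans (lam1 i)].
- move=> x /sum_hornP[g [t [Ag /andP[tt0 ts] xgt]]].
  have xgi (i : 'I_n) :
      `|x 0 (lift ord_max i) - g 0 (lift ord_max i)| <=
      t `^ lam 0 (lift ord_max i) * eta.
    by have := xgt (lift ord_max i); rewrite sub_delta_lift.
  have := xgt ord_max; rewrite sub_delta_max lamd powRr1 ?(ltW tt0)//.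
  have := Ap g Ag ord_max; rewrite ltr_distlC ler_distl => gd xd.
  (* The box descends at most [2 * t <= s / 4] below [g], so $x_d > p_d - 3s/8$, whereas $m - s \le
     p_d - 7s/8$. *)
  have x_low : m - s < x 0 ord_max by move: mM; rewrite /M; nra.
  have x_high : x 0 ord_max < prof (col' ord_max x).
    (* The vertex [g] itself gives only a weak inequality; raising it by [e / 2] inside the open set
       [A] makes it strict. *)
    have /open_rVP/(_ g Ag)[e e0 eA] := oA.
    pose g' := g + (e / 2) *: delta_mx 0 ord_max.
    have Ag' : A g'.
      apply: eA => i; rewrite !mxE opprD addNKr normrN.
      by case: (i == ord_max); rewrite ?andbF ?eqxx /= ?mulr1 ?mulr0 ?normr0 ?gtr0_norm; lra.
    have : g' 0 ord_max - c * t <= prof (col' ord_max x).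
      apply: (horn_profile_ge c0 AM); exists g', t; split=> // i.
      by rewrite !mxE eq_sym (negbTE (neq_lift _ _)) andbF mulr0 addr0.
    by rewrite !mxE !eqxx mulr1 /c; lra.
  pose X := append_last (s^-1 *: (col' ord_max x - b')) ((x 0 ord_max - (m - s)) / s).
  have sK (y : 'rV[R]_n) : s *: (s^-1 *: (y - b')) + b' = y.
    by rewrite scalerA divff ?gt_eqF// scale1r subrK.
  exists X; last first.
    rewrite fE col'_append_last append_last_max sK mulrC divfK ?gt_eqF// subrK.
    apply/rowP => i; move: i; apply: ord_max_ind => [|i].
      by rewrite append_last_max.
    by rewrite append_last_lift mxE.
  (* Horizontally [x] is within [s / 8 + s / 8 < s / 2] of [p], hence inside the open base cube. *)
  rewrite /Omega /= col'_append_last append_last_max; split=> [i|].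
    have := Ap g Ag (lift ord_max i); have := xgi i.
    have : t `^ lam 0 (lift ord_max i) * eta <= s / 8.
      have t1 : t <= 1 by lra.
      apply: le_trans (le_trans (powR_le_id tt0 t1 (lam1 i)) ts).
      by rewrite ler_piMr ?powR_ge0// ltW.
    rewrite !mxE ltr_distlC ler_distl => ? ? ?.
    by rewrite ltr_pdivlMl// ltr_pdivrMl//; apply/andP; split; lra.
  rewrite /psi sK divr_gt0//=; last lra.
  by rewrite ltr_pdivrMr// mulrDl mul1r divfK ?gt_eqF//; lra.
Qed.

End GraphPiece.

(** * Decomposition *)

Section FiniteUnions.
Context {T : Type}.
Implicit Types (P : set T -> Prop) (A B : set T).

Definition finite_union_of P A : Prop :=
  exists (N : nat) (D : 'I_N -> set T), A = \bigcup_k D k /\ forall k, P (D k).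

Lemma finite_union_of0 P : finite_union_of P set0.
Proof.
exists 0%N, (fun=> set0); split=> [|[]//].
by apply/seteqP; split=> [//|x [[]]].
Qed.

Lemma finite_union_of1 P A : P A -> finite_union_of P A.
Proof.
move=> PA; exists 1%N, (fun=> A); split=> //.
by apply/seteqP; split=> [x Ax|x [_ _ //]]; exists ord0.
Qed.

Lemma finite_union_ofU P A B :
  finite_union_of P A -> finite_union_of P B -> finite_union_of P (A `|` B).
Proof.
move=> [N [D [-> PD]]] [M [E [-> PE]]].
exists (N + M)%N, (fun k : 'I_(N + M) =>
  match fintype.split k with inl i => D i | inr j => E j end).
split=> [|k]; last by case: fintype.split.
apply/seteqP; split=> [x [[i _ Dx]|[j _ Ex]]|x [k _]].
- by exists (lshift M i); rewrite // (unsplitK (inl i)).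
- by exists (rshift N j); rewrite // (unsplitK (inr j)).
- by case: fintype.split => [i Dx|j Ex]; [left; exists i|right; exists j].
Qed.

Lemma finite_union_of_seq P (I : eqType) (s : seq I) (F : I -> set T) :
  (forall i, finite_union_of P (F i)) ->
  finite_union_of P (\bigcup_(i in [set` s]) F i).
Proof.
move=> PF; elim: s => [|i s IHs].
  have -> : \bigcup_(j in [set` [::]]) F j = set0 by apply/seteqP; split=> x [].
  exact: finite_union_of0.
have -> : \bigcup_(j in [set` i :: s]) F j = F i `|` \bigcup_(j in [set` s]) F j.
  apply/seteqP; split=> x; rewrite /bigcup /= /setU /=.
    by move=> [j /=]; rewrite inE => /predU1P[->|js]; [left|right; exists j].
  move=> [Fx|[j js Fx]]; first by exists i; rewrite //= mem_head.
  by exists j; rewrite //= inE js orbT.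
exact: finite_union_ofU.
Qed.

Lemma finite_union_of_fin P (I : finType) (F : I -> set T) :
  (forall i, finite_union_of P (F i)) -> finite_union_of P (\bigcup_i F i).
Proof.
move=> PF; have -> : \bigcup_i F i = \bigcup_(i in [set` enum I]) F i.
  by apply/seteqP; split=> x [i _ Fx]; exists i => //=; rewrite mem_enum.
exact: finite_union_of_seq.
Qed.

Lemma finite_union_of_sub P P' A : (forall B, P B -> P' B) ->
  finite_union_of P A -> finite_union_of P' A.
Proof. by move=> PP' [N [D [-> PD]]]; exists N, D; split=> // k; exact: PP'. Qed.

End FiniteUnions.

Section Decomposition.
Context {R : realType} {n : nat}.
Implicit Types (A H : set 'rV[R]_n.+1) (lam : 'rV[R]_n.+1) (Q : 'M[R]_n.+1).

(** The alternative of the theorem for one fixed index [j]. *)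
Definition nice_domain alpha lam (D : set 'rV[R]_n.+1) : Prop :=
  domain D /\ (cone_condition D \/
    class_G' (fun (i : 'I_n) t => alpha * t `^ lam 0 (lift ord_max i)) D).

Lemma minkowski_sumU A (B C : set 'rV[R]_n.+1) :
  minkowski_sum A (B `|` C) = minkowski_sum A B `|` minkowski_sum A C.
Proof.
apply/seteqP; split=> [_ [x Ax [y [By|Cy] <-]]|_ [[x Ax [y By <-]]|[x Ax [y Cy <-]]]].
- by left; exists x => //; exists y.
- by right; exists x => //; exists y.
- by exists x => //; exists y => //; left.
- by exists x => //; exists y => //; right.
Qed.

(* For [eta >= 1] the boxes forming the horn are nested, so that the horn is a
   single box. *)
Lemma wide_horn eta T lam A : 1 <= eta -> 0 < T ->
  (forall i, 1 <= lam 0 i) -> lam 0 ord_max = 1 ->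
  minkowski_sum A (V_set eta T lam) =
  minkowski_sum A (horn eta [set t | T <= t <= T] lam).
Proof.
move=> eta1 T0 lam1 lamd; apply/seteqP; split=> x /sum_hornP.
  move=> [g [t [Ag /andP[t0 tT] xgt]]]; apply/sum_hornP; exists g, T.
  split=> //=; first by rewrite lexx.
  apply: ord_max_ind => [|i].
    (* As [t] grows, the top face $g_d + (\eta - 1)t$ does not descend and the bottom face $g_d -
       (\eta + 1)t$ descends. *)
    have := xgt ord_max; rewrite !sub_delta_max lamd !powRr1 ?(ltW t0) ?(ltW T0)//.
    by rewrite !ler_distl => /andP[? ?]; apply/andP; split; nra.
  have := xgt (lift ord_max i); rewrite !sub_delta_lift => /le_trans; apply.
  rewrite ler_pM2r ?(lt_le_trans ltr01)// le_powR_le//.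
  exact: le_trans (lam1 _).
move=> [g [t [Ag Tt xgt]]]; apply/sum_hornP; exists g, t; split=> //=.
by case/andP: Tt => Tt tT; rewrite tT andbT (lt_le_trans T0).
Qed.

Lemma horn_split eta T e lam : 0 < e -> e <= T ->
  V_set eta T lam =
  horn eta [set t | 0 < t <= e] lam `|` horn eta [set t | e <= t <= T] lam.
Proof.
move=> e0 eT; rewrite /horn -bigcup_setU; congr bigcup.
apply/seteqP; split=> t /=.
  move=> /andP[t0 tT]; have [te|et] := leP t e; [left|right].
    by rewrite /= t0.
  by rewrite /= ltW.
case=> /andP[? ?]; apply/andP; split; lra.
Qed.

(** The constants [alpha] and [delta] are fixed before the cell [A], so all the cells of one $G_j$
    share a single class. *)
Lemma horn_local_decomposition eta T lam Q : 0 < eta -> 0 < T ->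
  (forall i : 'I_n, 1 <= lam 0 (lift ord_max i)) -> lam 0 ord_max = 1 ->
  orthogonal_mx Q ->
  exists alpha delta : R, [/\ 0 < alpha <= 1, 0 < delta &
    forall (p : 'rV[R]_n.+1) A, open A ->
      (forall g, A g -> forall i, `|p 0 i - g 0 i| < delta) ->
      finite_union_of (nice_domain alpha lam)
        ((fun x => x *m Q) @` minkowski_sum A (V_set eta T lam))].
Proof.
move=> eta0 T0 laml lamd oQ.
have lam1 i : 1 <= lam 0 i.
  by move: i; apply: ord_max_ind => [|i]; [rewrite lamd|exact: laml].
have lam0 i : 0 <= lam 0 i by exact: le_trans (lam1 i).
have cone_nice alpha D : cone_condition D ->
    finite_union_of (nice_domain alpha lam) ((fun x => x *m Q) @` D).
  move=> cD; apply: finite_union_of1.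
  have cDQ := cone_condition_mulmx oQ cD.
  by split; [case: cDQ|left].
have empty_nice alpha A : ~ (A !=set0) -> finite_union_of (nice_domain alpha lam)
    ((fun x => x *m Q) @` minkowski_sum A (V_set eta T lam)).
  move=> /set0P/negP/negPn/eqP ->.
  suff -> : (fun x => x *m Q) @` minkowski_sum set0 (V_set eta T lam) = set0.
    exact: finite_union_of0.
  by apply/seteqP; split=> // _ [_ [x []]].
have dist2 (p g h : 'rV[R]_n.+1) (delta : R) i : `|p 0 i - g 0 i| < delta ->
    `|p 0 i - h 0 i| < delta -> `|g 0 i - h 0 i| <= 2 * delta.
  rewrite !ltr_distlC ler_distl => /andP[? ?] /andP[? ?].
  by apply/andP; split; lra.
have [eta1|eta1] := leP 1 eta.
  have [r r0 rP] : exists2 r : R, 0 < r & forall i, r <= T `^ lam 0 i * eta.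
    by apply: positive_lower_bound => i; rewrite mulr_gt0 ?powR_gt0.
  (* Only cone domains arise here, so 1 is a default value for [alpha]. Two points of a cell differ
     by at most [r] in each coordinate, hence by at most a half-side of the box at parameter [T]. *)
  exists 1, (r / 2); split; [by rewrite ltr01 lexx|exact: divr_gt0|].
  move=> p A oA Ap; have [A0|] := pselect (A !=set0); last exact: empty_nice.
  rewrite wide_horn//; apply: cone_nice.
  apply: truncated_horn_cone_condition => // g h Ag Ah i.
  apply: le_trans (rP i); have := dist2 p g h _ _ (Ap g Ag i) (Ap h Ah i); lra.
(* [L] dominates every exponent, so for [t <= 1] the single power $t^L$ lies below all
   $t^{\lambda_i}$; this yields one [s] and one [alpha] for all coordinates. *)
pose L := \sum_i lam 0 i; pose t0 := Num.min 1 T / 2.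
have lamL i : lam 0 i <= L by rewrite /L (bigD1 i)//= lerDl sumr_ge0.
have powL (t : R) i : 0 < t -> t <= 1 -> t `^ L <= t `^ lam 0 i.
  by move=> t_gt0 t_le1; rewrite ger_powR ?t_gt0.
have t00 : 0 < t0 by rewrite divr_gt0// lt_min ltr01.
have t0T : 2 * t0 <= T by rewrite mulrC divfK ?pnatr_eq0// ge_min lexx orbT.
have t01 : t0 <= 1.
  have : Num.min 1 T <= 1 by rewrite ge_min lexx.
  by rewrite /t0; lra.
have L1 : 1 <= L by apply: le_trans (lamL ord_max); rewrite lamd.
(* Both factors are at most 1, so [s] is below [(1 - eta) * t0] and below every
   $t_0^{\lambda_i}\eta$. *)
pose s := (1 - eta) * (t0 `^ L * eta).
have tL0 : 0 < t0 `^ L * eta by rewrite mulr_gt0// powR_gt0.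
have s0 : 0 < s by rewrite mulr_gt0// subr_gt0.
have s_tL : s <= t0 `^ L * eta by rewrite ler_piMl ?(ltW tL0)// gerBl ltW.
have tLt : t0 `^ L * eta <= t0.
  apply: le_trans (powR_le_id t00 t01 L1).
  by rewrite ler_piMr ?powR_ge0// ltW.
have st0 : s <= (1 - eta) * t0 by rewrite ler_wpM2l// subr_ge0 ltW.
have s_le1 : s <= 1 by apply: le_trans s_tL (le_trans tLt t01).
have sP i : s <= t0 `^ lam 0 i * eta.
  by apply: le_trans s_tL _; rewrite ler_pM2r// powL.
have sL0 : 0 < s `^ L * eta by rewrite mulr_gt0// powR_gt0.
have eta01 : 0 < eta < 1 by rewrite eta0.
have alpha01 : 0 < s `^ L * eta <= 1.
  rewrite sL0 mulr_ile1 ?powR_ge0 ?(ltW eta0) ?(ltW eta1)//.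
  exact: le_trans (powR_le_id s0 s_le1 L1) s_le1.
have alphaP (i : 'I_n) : s `^ L * eta <= s `^ lam 0 (lift ord_max i) * eta.
  by rewrite ler_pM2r// powL.
have s8_gt0 : 0 < s / 8 by exact: divr_gt0.
have s8T : s / 8 <= T by lra.
exists (s `^ L * eta), (s / 8); split=> // p A oA Ap.
have [A0|] := pselect (A !=set0); last exact: empty_nice.
have [D [b [GO OV VO]]] := horn_graph_piece eta01 laml lamd t00 t0T s0 s_le1 st0
  (fun i => sP (lift ord_max i)) alpha01 alphaP oA A0 Ap.
(* The graph piece stays inside the sum and absorbs the parameters up to [s / 8]; the truncated horn
   supplies the others. The two may overlap. *)
have -> : minkowski_sum A (V_set eta T lam) = (fun x => s *: x + b) @` D `|`
    minkowski_sum A (horn eta [set t | s / 8 <= t <= T] lam).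
  have VE := horn_split eta lam s8_gt0 s8T.
  apply/seteqP; split=> [x|x [/OV//|]]; rewrite VE minkowski_sumU.
    by case=> [/VO|]; [left|right].
  by right.
rewrite image_setU; apply: finite_union_ofU.
  apply: finite_union_of1; rewrite image_comp.
  have dO := class_G_domain GO.
  have sim : similarity ((fun x => x *m Q) \o (fun x => s *: x + b)).
    exists s, Q, (b *m Q); split=> [||x] //=; first by rewrite gt_eqF.
    by rewrite mulmxDl -scalemxAl.
  have GQ := class_G'_similarity dO GO sim.
  by split; [case: GQ|right].
apply: cone_nice; apply: truncated_horn_cone_condition => //.
move=> g h Ag Ah i; have := dist2 p g h _ _ (Ap g Ag i) (Ap h Ah i).
have : t0 `^ lam 0 i * eta <= T `^ lam 0 i * eta.
  by rewrite ler_pM2r// le_powR_le//; lra.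
by have := sP i; lra.
Qed.

Lemma bounded_preimage_finite_cover (G0 : set 'rV[R]_n.+1) Q (delta : R) :
  bounded_set G0 -> orthogonal_mx Q -> 0 < delta ->
  exists s : seq 'rV[R]_n.+1, forall x, G0 (x *m Q) ->
    exists2 p, p \in s & forall i, `|p 0 i - x 0 i| < delta.
Proof.
move=> [M [_ MG0]] oQ d0.
(* Boundedness gives norm at most any number above [M], such as [M + 1]; a further 1 gives the
   strict inequality for the ball. *)
pose K : set 'rV[R]_n.+1 :=
  [set v | forall i, (`[- (M + 2), M + 2]%classic : set R) (v ord0 i)].
have cK : compact K.
  by apply: (@rV_compact R _ (fun=> `[- (M + 2), M + 2]%classic)) => _;
    exact: segment_compact.
have cKQ : compact ((fun x => x *m Q^T) @` K).
  by apply: continuous_compact => //; apply: continuous_subspaceT;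
    exact: mulmxr_continuous.
have [s sP] := compact_finite_cover cKQ d0.
exists s => x G0x; apply: sP; exists (x *m Q); last first.
  by rewrite -mulmxA oQ mulmx1.
have xM : `|x *m Q| <= M + 1 by apply: MG0 => //; rewrite ltrDl.
have M2 : 0 < M + 2 by have := normr_ge0 (x *m Q); lra.
have : ball 0 (M + 2) (x *m Q).
  by rewrite -ball_normE /ball_ /= sub0r normrN; lra.
move=> /(ball_rVP _ _ M2) xQ i; have := xQ i.
by rewrite /= in_itv/= mxE sub0r normrN ltr_norml; lra.
Qed.

(** As $G_0 + VQ = (G_0Q^{-1} + V)Q$, the set to be cut into cells is $G_0Q^{-1}$, and each cell is
    rotated back by [Q]. *)
Lemma horn_decomposition eta T lam Q (G0 : set 'rV[R]_n.+1) :
  0 < eta -> 0 < T ->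
  (forall i : 'I_n, 1 <= lam 0 (lift ord_max i)) -> lam 0 ord_max = 1 ->
  orthogonal_mx Q -> open G0 -> bounded_set G0 ->
  exists2 alpha : R, 0 < alpha <= 1 & finite_union_of (nice_domain alpha lam)
    (minkowski_sum G0 [set x *m Q | x in V_set eta T lam]).
Proof.
move=> eta0 T0 laml lamd oQ oG bG.
have [alpha [delta [alpha01 d0 loc]]] :=
  horn_local_decomposition eta0 T0 laml lamd oQ.
exists alpha => //.
have [s sP] := bounded_preimage_finite_cover bG oQ d0.
pose cell p := [set x | G0 (x *m Q)] `&` ball p delta.
have cellP p x : cell p x <->
    G0 (x *m Q) /\ forall i, `|p 0 i - x 0 i| < delta.
  by rewrite /cell /setI /=; split=> -[? /(ball_rVP _ _ d0)].
have -> : minkowski_sum G0 [set x *m Q | x in V_set eta T lam] =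
    \bigcup_(p in [set` s])
      ((fun x => x *m Q) @` minkowski_sum (cell p) (V_set eta T lam)).
  apply/seteqP; split=> [_ [x Gx [_ [v Vv <-] <-]]|
      _ [p _ [_ [x /cellP[Gx _] [v Vv <-] <-]]]]; last first.
    by exists (x *m Q) => //; exists (v *m Q); rewrite ?mulmxDl//; exists v.
  have xK : x *m Q^T *m Q = x by rewrite -mulmxA orthogonal_mxV// mulmx1.
  have [|p ps px] := sP (x *m Q^T); first by rewrite xK.
  exists p => //; exists (x *m Q^T + v); last by rewrite mulmxDl xK.
  exists (x *m Q^T); last by exists v.
  by apply/cellP; rewrite xK.
apply: finite_union_of_seq => p; apply: loc (p) _ _ _ => [|g /cellP[]//].
apply: openI; last first.
  exact: ball_open.
by apply: open_comp => // x _; exact: mulmxr_continuous.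
Qed.

End Decomposition.

Theorem mainTheorem6 (R : realType) (n : nat) (hd : (2 <= n.+1)%N)
    (eta T : R) (heta : 0 < eta) (hT : 0 < T)
    (j0 : nat) (Gs : 'I_j0 -> set 'rV[R]_n.+1) (Q : 'I_j0 -> 'M[R]_n.+1)
    (lam : 'I_j0 -> 'rV[R]_n.+1) (Lambda : R) (G : set 'rV[R]_n.+1)
    (hGs_open : forall j, open (Gs j))
    (hGs_bounded : forall j, bounded_set (Gs j))
    (hQ : forall j, orthogonal_mx (Q j))
    (hlam_ge1 : forall j (i : 'I_n), 1 <= lam j 0 (lift ord_max i))
    (hlam_last : forall j, lam j 0 ord_max = 1)
    (hlam_sum : forall j, \sum_(i < n.+1) lam j 0 i = Lambda)
    (hG : domain G)
    (hGE : G = \bigcup_j minkowski_sum (Gs j)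
                 [set x *m Q j | x in V_set eta T (lam j)]) :
  exists alpha : 'I_j0 -> R,
    (forall j, 0 < alpha j <= 1) /\
    exists (N : nat) (D : 'I_N -> set 'rV[R]_n.+1),
      G = \bigcup_k D k /\
      forall k, domain (D k) /\
        (cone_condition (D k) \/
         exists j, class_G' (fun (i : 'I_n) (t : R) =>
                      alpha j * t `^ lam j 0 (lift ord_max i)) (D k)).
Proof.
have dec j := horn_decomposition heta hT (hlam_ge1 j) (hlam_last j) (hQ j)
  (hGs_open j) (hGs_bounded j).
have /choice[alpha alphaP] : forall j, exists a : R, 0 < a <= 1 /\
    finite_union_of (nice_domain a (lam j))
      (minkowski_sum (Gs j) [set x *m Q j | x in V_set eta T (lam j)]).
  by move=> j; have [a] := dec j; exists a.
exists alpha; split=> [j|]; first by case: (alphaP j).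
rewrite hGE; apply: (@finite_union_of_fin _ (fun D => domain D /\
  (cone_condition D \/ exists j, class_G' (fun (i : 'I_n) (t : R) =>
     alpha j * t `^ lam j 0 (lift ord_max i)) D))) => j.
apply: finite_union_of_sub (alphaP j).2 => D [dD [cD|GD]]; split=> //.
  by left.
by right; exists j.
Qed.
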